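(* Fix a configuration $c\in\mathcal C$ and two distinct programs $f,g\in\mathcal F$. For the single-block design $\beta(n)$ (with $n$ a positive multiple of $\mathrm F=|\mathcal F|$), the bias of the estimator $\hat\Delta^c(f,g)$ of $\delta^c(f,g)$ satisfies $$\operatorname{E}[\hat\Delta^c(f,g)-\delta^c(f,g)] = O(n^{-1/2})\qquad (n\to\infty).$$
   Context: Measurement model. $\mathcal F$ is a finite set of programs, $\mathrm F=|\mathcal F|\ge 2$; $\mathcal C$ is a set of configurations. For a fixed configuration $c$, an experiment with $n$ runs generates programs $F_1,\dots,F_n\in\mathcal F$, unobserved uncontrolled states $U_1,U_2,\dots\in\mathcal U$, and real measurements $T_1,\dots,T_n$ sequentially: the initial state $U_1$ is supplied by the environment (arbitrary distribution); at run $i$ the design chooses $F_i$ (using only previously observed variables), then $T_i$ is drawn from a fixed unknown conditional distribution of $T$ given $(U=U_i,F=F_i,c)$, then $U_{i+1}$ is drawn from a fixed unknown conditional distribution given $(T=T_i,U=U_i,F=F_i,c)$. These two conditional distributions depend neither on $i$ nor on the design. Delta design. A design is a delta design if the following hold. (1) Additive global effect: $T_i=\mathcal T_i+\mathcal E_i$, where, conditionally on $F_{\le i},U_{\le i},T_{<i}$, the ''true run time'' $\mathcal T_i$ and the ''environmental noise'' $\mathcal E_i$ are independent, $\mathcal T_i$ has a fixed distribution depending only on $(F_i,c)$, and $\mathcal E_i$ has a fixed distribution depending only on $(U_i,c)$. (In the multiplicative version of the assumption, $T,\mathcal T,\mathcal E$ stand for the logarithms of the positive quantities, so the same additive formulation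 applies.) (2) $T$ is essentially bounded (hence so are $\mathcal T$ and $\mathcal E$, given $c$). (3) $F_i$ is conditionally independent of the earlier measurements and of the configuration given $F_{<i}$ (together with the sequential structure above, $F_i$ depends on the past only through $F_{<i}$), and each $F_i$ has full support $\mathcal F$. (4) The loss estimator is $\hat L(f,c)=\bar T_f=\frac1{N_f}\sum_{i=1}^n \mathbb 1_{F_i=f}T_i$, where $N_f=\sum_{i=1}^n\mathbb 1_{F_i=f}$. True loss and deltas. The true loss is $l(f,c)=\operatorname E[T\mid f,c]$, the expectation being over $T$ given $(U,f,c)$ with $U$ drawn from a fixed reference distribution $U\mid c$ that does not depend on $f$; thus $l(f,c)=\operatorname E[\mathcal T\mid f,c]+\operatorname E_{U\mid c}[\mathcal E]$. The true delta is $\delta^c(f,g)=l(f,c)-l(g,c)$ and the estimated delta is $\hat\Delta^c(f,g)=\hat L(f,c)-\hat L(g,c)$. Single-block design $\beta(n)$. For $n$ divisible by $\mathrm F$, $\beta(n)$ is the delta design in which $(F_1,\dots,F_n)$ are sampled without replacement from the multiset containing exactly $n/\mathrm F$ copies of each program. *)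

(* Defs.v *)
From HB Require Import structures.
From mathcomp Require Export all_boot all_order all_algebra.
From mathcomp Require Export all_classical all_reals all_analysis measurable_realfun.

Export Order.TTheory GRing.Theory Num.Theory.
Export numFieldNormedType.Exports.

Local Open Scope classical_set_scope.
Local Open Scope ring_scope.

(* [time_law c f u] is the law of T given (U = u, F = f, c); [step_law c f (t, u)]
   is the law of the next state given (T = t, U = u, F = f, c); [ref c] is the
   reference distribution U | c, used only to define the true loss. *)
Record model (R : realType) (prog : finType) (config : Type)
    {d : measure_display} (state : measurableType d) := Model {
  time_law : config -> prog -> R.-pker state ~> R;
  step_law : config -> prog -> R.-pker (R * state)%type ~> state;
  ref : config -> probability state R }.

(* Laws of the true run time (given F and c) and of the environmental noise
   (given U and c). *)
Record effects (R : realType) (prog : finType) (config : Type)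
    {d : measure_display} (state : measurableType d) := Effects {
  true_time_law : config -> prog -> probability R R;
  noise_law : config -> R.-pker state ~> R }.

(* Runs are numbered from 0: index i stands for the (i+1)-th run.  In an
   experiment with n runs only the indices i < n (and the state of index n)
   are constrained. *)
Record experiment (R : realType) (prog : finType)
    {d : measure_display} (state : measurableType d) := Experiment {
  disp : measure_display;
  Omega : measurableType disp;
  Pr : probability Omega R;
  program : nat -> Omega -> prog;
  program_measurable : forall i f, measurable [set w | program i w = f];
  state_at : nat -> {mfun Omega >-> state};
  time_at : nat -> {mfun Omega >-> R};
  true_time_at : nat -> {mfun Omega >-> R};
  noise_at : nat -> {mfun Omega >-> R} }.

Arguments time_law {R prog config d state}.
Arguments step_law {R prog config d state}.
Arguments ref {R prog config d state}.
Arguments true_time_law {R prog config d state}.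
Arguments noise_law {R prog config d state}.
Arguments disp {R prog d state}.
Arguments Omega {R prog d state}.
Arguments Pr {R prog d state}.
Arguments program {R prog d state}.
Arguments program_measurable {R prog d state}.
Arguments state_at {R prog d state}.
Arguments time_at {R prog d state}.
Arguments true_time_at {R prog d state}.
Arguments noise_at {R prog d state}.

Section Experiments.
Context (R : realType) (prog : finType) (config : Type)
  {d : measure_display} (state : measurableType d).
Implicit Types (m : model R prog config state) (e : effects R prog config state)
  (X : experiment R prog state) (c : config) (f g : prog) (n : nat).

(* sigma-algebra generated by the first a programs, the first b states and the
   first k measurements *)
Definition history X (a b k : nat) : set_system (Omega X) :=
  <<s [set A | (exists i f, (i < a)%N /\ A = [set w | program X i w = f]) \/
               (exists i B, [/\ (i < b)%N, measurable B & A = state_at X i @^-1` B]) \/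
               (exists i B, [/\ (i < k)%N, measurable B & A = time_at X i @^-1` B])] >>.

(* p is a version of the conditional probability of E given the
   sub-sigma-algebra G *)
Definition cond_prob {d' : measure_display} {T : measurableType d'}
    (P : probability T R) (G : set_system T) (E : set T) (p : T -> \bar R) : Prop :=
  (forall V : set (\bar R), measurable V -> G (p @^-1` V)) /\
  (forall A, G A -> P (A `&` E) = (\int[P]_(w in A) p w)%E).

(* In both laws the conditioning is on the whole past, so that they depend on
   it only through the arguments shown; the initial state is unconstrained. *)
Definition follows_model m c n X : Prop :=
  forall i, (i < n)%N ->
    (forall B, measurable B ->
      cond_prob (Pr X) (history X i.+1 i.+1 i) (time_at X i @^-1` B)
        (fun w => time_law m c (program X i w) (state_at X i w) B)) /\
    (forall B, measurable B ->
      cond_prob (Pr X) (history X i.+1 i.+1 i.+1) (state_at X i.+1 @^-1` B)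
        (fun w => step_law m c (program X i w)
                    (time_at X i w, state_at X i w) B)).

(* [q s f] is the probability that the next program is f when the previous
   programs are s, in order.  By its type it can depend neither on the
   measurements nor on the configuration. *)
Definition design : Type := seq prog -> prog -> R.

Definition past_programs X i (w : Omega X) : seq prog :=
  mkseq (fun j => program X j w) i.

Definition additive_effect e c n X : Prop :=
  forall i, (i < n)%N ->
    (forall w, time_at X i w = true_time_at X i w + noise_at X i w) /\
    (forall A B, measurable A -> measurable B ->
      cond_prob (Pr X) (history X i.+1 i.+1 i)
        (true_time_at X i @^-1` A `&` noise_at X i @^-1` B)
        (fun w => true_time_law e c (program X i w) A
                  * noise_law e c (state_at X i w) B)%E).

Definition bounded_times (M : R) n X : Prop :=
  forall i, (i < n)%N -> {ae Pr X, forall w, `|time_at X i w| <= M}.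

Definition program_design (q : design) n X : Prop :=
  forall i f, (i < n)%N ->
    cond_prob (Pr X) (history X i i.+1 i) [set w | program X i w = f]
      (fun w => (q (past_programs X i w) f)%:E) /\
    (0 < Pr X [set w | program X i w = f])%E.

(* [additive_effect] and [bounded_times] only constrain T at the states visited
   by the runs; the next two conditions constrain the law of T given (U, f, c)
   with U drawn from the reference distribution, on which the true loss depends. *)
Definition reference_additive m e c : Prop :=
  forall f, {ae ref m c, forall u, forall B, measurable B ->
    time_law m c f u B =
    (true_time_law e c f \x noise_law e c u)%E [set x | B (x.1 + x.2)]}.

Definition reference_bounded m (M : R) c : Prop :=
  forall f, {ae ref m c, forall u,
    {ae time_law m c f u, forall t, `|t| <= M}}.

Definition delta_design m e M c (q : design) n X : Prop :=
  [/\ follows_model m c n X, additive_effect e c n X,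
      bounded_times M n X & program_design q n X].

(* Draw without replacement: after the programs s have been drawn, the urn
   contains n - size s programs, n / #|prog| - count_mem f s of which are f. *)
Definition single_block n : design :=
  fun (s : seq prog) (f : prog) => (n %/ #|prog| - count_mem f s)%N%:R / (n - size s)%N%:R.

Definition count_runs X n f (w : Omega X) : R :=
  \sum_(i < n) (program X i w == f)%:R.

Definition loss_est X n f (w : Omega X) : R :=
  (count_runs X n f w)^-1 * \sum_(i < n) (program X i w == f)%:R * time_at X i w.

Definition delta_est X n f g (w : Omega X) : R :=
  loss_est X n f w - loss_est X n g w.

Definition true_loss m c f : R :=
  fine (\int[ref m c]_u \int[time_law m c f u]_t t%:E)%E.

Definition true_delta m c f g : R := true_loss m c f - true_loss m c g.

Definition delta_error m c f g n X (w : Omega X) : R :=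
  delta_est X n f g w - true_delta m c f g.

End Experiments.

Arguments delta_design {R prog config d state}.
Arguments reference_additive {R prog config d state}.
Arguments reference_bounded {R prog config d state}.
Arguments single_block {R prog}.
Arguments delta_error {R prog config d state}.

(* Main.v *)
From HB Require Import structures.
From mathcomp Require Import ring lra.
Require Import Defs.

(* The true run times contribute no bias, because each program is run exactly
   n / F times.  The noise of run i depends only on the state, which is
   independent of the program of run i given the previous programs; the bias is
   therefore (F / n) sum_i E[(q_i(f) - q_i(g)) noise_i], where q_i is the
   composition of the urn after i draws.  With D_i the difference between the
   numbers of f and g drawn so far, q_i(g) - q_i(f) = D_i / (n - i), and the urn
   pulls D_i back towards 0 so strongly that E[D_i ^ 2] <= n - i.  Hence
   E|q_i(f) - q_i(g)| <= (n - i)^(-1/2), and these bounds add up to O(sqrt n). *)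

(** Only T is assumed bounded, so bounds on its two summands must be extracted. Fix A such that
    every true-time law gives [-A, A] positive mass; one A serves all programs, as they are finitely
    many. Given the program, true time and noise are independent, so noise beyond |M| + A would meet
    a small true time with positive probability and push |T| past M. This bounds the noise along the
    runs, whatever states they visit. Those states need not resemble the reference distribution,
    which alone enters the true loss. The means of the true times are therefore reached separately:
    at a reference state the law of T is a convolution, whose factors are bounded by the same
    argument. The state may remember past programs, so the noise can be correlated with the gap D_i,
    even in sign. Hence the mean of D_i being 0 does not help, and its absolute first moment is what
    has to be controlled. *)

Set Implicit Arguments.
Unset Strict Implicit.
Unset Printing Implicit Defensive.

Local Open Scope classical_set_scope.
Local Open Scope ring_scope.

Arguments history {R prog d state}.
Arguments past_programs {R prog d state}.
Arguments program_design {R prog d state}.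
Arguments additive_effect {R prog config d state}.
Arguments bounded_times {R prog d state}.
Arguments count_runs {R prog d state}.
Arguments loss_est {R prog d state}.
Arguments true_loss {R prog config d state}.
Arguments true_delta {R prog config d state}.

(** * Drawing without replacement *)

Lemma sum_tuple_rcons (R : nmodType) (T : finType) (i : nat) (h : seq T -> R) :
  \sum_(t : i.+1.-tuple T) h t = \sum_(s : i.-tuple T) \sum_x h (rcons s x).
Proof.
rewrite pair_big /=.
pose join (u : i.-tuple T * T) := [tuple of rcons u.1 u.2].
pose split (t : i.+1.-tuple T) :=
  ([tuple of belast (thead t) (behead t)], last (thead t) (behead t)).
have joinK : cancel join split.
  case=> s x; rewrite /split /join /=; set t := [tuple of rcons _ _].
  have e : thead t :: behead t = rcons s x.
    by rewrite -[RHS]/(tval t); case/tupleP: t => y t'; rewrite theadE.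
  have : rcons (belast (thead t) (behead t)) (last (thead t) (behead t))
      = rcons s x by rewrite -lastI.
  move=> /rcons_inj [e1 e2]; congr pair => //; apply: val_inj; exact: e1.
have splitK : cancel split join.
  move=> t; apply: val_inj; rewrite /= -lastI.
  by case/tupleP: t => y t'; rewrite theadE.
by rewrite (reindex join) //=; exists split => ? _; [apply: joinK|apply: splitK].
Qed.

Section Urn.
(** [p s] stands for the probability that the first [size s] programs are [s]. Knowing it only
    through its chain rule keeps the whole computation within finite sums. *)
Context {R : realType} {prog : finType} (n : nat) (p : seq prog -> R).
Hypothesis dvdn_card : (#|prog| %| n)%N.
Hypotheses (p_ge0 : forall s, 0 <= p s) (p_nil : p [::] = 1).
Hypothesis p_rcons : forall s x, (size s < n)%N ->
  p (rcons s x) = single_block n s x * p s.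

Local Notation b := (n %/ #|prog|)%N.
Local Notation q := (@single_block R prog n).

(** Once the [b] copies of a program are used up, its draw probability is 0, so no sequence of
    nonzero probability overdraws. On such sequences the truncated subtraction in [single_block] is
    a true one. *)
Lemma block_count_le s x : (size s <= n)%N -> p s != 0 -> (count_mem x s <= b)%N.
Proof.
elim/last_ind: s => [//|s y IH]; rewrite size_rcons => sn.
rewrite p_rcons // mulf_eq0 negb_or => /andP[q_neq0 p_neq0].
rewrite -cats1 count_cat /= addn0; have := IH (ltnW sn) p_neq0.
case: eqP => [yx _|_]; last by rewrite addn0.
rewrite addn1 ltnNge; apply: contra q_neq0; rewrite -yx /single_block => le.
by have /eqP -> : (b - count_mem y s == 0)%N; rewrite ?mul0r // subn_eq0.
Qed.

Lemma sum_count_mem (s : seq prog) : (\sum_x count_mem x s = size s)%N.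
Proof.
elim: s => [|y s IH] /=; first by rewrite big1.
rewrite big_split /= IH (bigD1 y) //= eqxx big1 ?addn0 // => x /negPf.
by rewrite eq_sym => ->.
Qed.

(** No count exceeds [b], and the counts add up to [n], which is [b] times the number of programs;
    one deficient count would make the total too small. *)
Lemma block_count_full s x : size s = n -> p s != 0 -> count_mem x s = b.
Proof.
move=> sn ps; apply/eqP; rewrite eqn_leq block_count_le ?sn //= leqNgt.
apply/negP => lt; have := sum_count_mem s; rewrite sn.
have : (\sum_(y : prog) count_mem y s < \sum_(y : prog) b)%N.
  rewrite (bigD1 x) //= [X in (_ < X)%N](bigD1 x) //=.
  rewrite -addSn leq_add //; apply: leq_sum => y _.
  by rewrite block_count_le ?sn.
rewrite sum_nat_const mulnC divnK //.
by move=> /[swap] ->; rewrite ltnn.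
Qed.

Lemma block_ge0 s x : 0 <= q s x.
Proof. by rewrite mulr_ge0. Qed.

Lemma blockE s x : (size s < n)%N -> p s != 0 ->
  q s x = (b%:R - (count_mem x s)%:R) / (n%:R - (size s)%:R).
Proof.
move=> sn ps; rewrite /single_block natrB ?block_count_le 1?ltnW //.
by rewrite natrB // ltnW.
Qed.

Lemma sum_block s : (size s < n)%N -> p s != 0 -> \sum_x q s x = 1.
Proof.
move=> sn ps; under eq_bigr do rewrite blockE //.
rewrite -mulr_suml sumrB sumr_const -natr_sum sum_count_mem -mulrnA divnK //.
by rewrite divff // subr_eq0 eqr_nat neq_ltn sn orbT.
Qed.

(** The tower property: the last draw is averaged first, given the earlier ones. *)
Lemma sum_urn_succ (i : nat) (h : seq prog -> R) : (i < n)%N ->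
  \sum_(t : i.+1.-tuple prog) p t * h t =
  \sum_(s : i.-tuple prog) p s * \sum_x q s x * h (rcons s x).
Proof.
move=> i_n; rewrite (sum_tuple_rcons _ (fun t => p t * h t)); apply: eq_bigr => s _.
rewrite mulr_sumr; apply: eq_bigr => x _.
by rewrite p_rcons ?size_tuple // mulrCA mulrA.
Qed.

Lemma sum_urn (i : nat) : (i <= n)%N -> \sum_(s : i.-tuple prog) p s = 1.
Proof.
elim: i => [_|i IH i_n].
  rewrite (big_pred1 [tuple]) ?p_nil // => t; rewrite [t]tuple0.
  by rewrite /= eqxx.
under eq_bigr do rewrite -[p _]mulr1.
rewrite (sum_urn_succ (fun=> 1)) // -[RHS]IH 1?ltnW //.
apply: eq_bigr => s _; under eq_bigr do rewrite mulr1.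
have [->|ps] := eqVneq (p s) 0; first by rewrite mul0r.
by rewrite sum_block ?size_tuple // mulr1.
Qed.

Context (f g : prog).
Hypothesis f_neq_g : f != g.

Let gap (s : seq prog) : R := (count_mem f s)%:R - (count_mem g s)%:R.

Lemma gap_rcons s x : gap (rcons s x) = gap s + ((x == f)%:R - (x == g)%:R).
Proof.
by rewrite /gap -cats1 !count_cat /= !addn0 !natrD opprD addrACA.
Qed.

(* The gap is pulled back towards 0: its conditional drift is
   - gap / (n - i). *)
Lemma gap_second_moment_step s : (size s < n)%N -> p s != 0 ->
  \sum_x q s x * gap (rcons s x) ^+ 2 <=
  gap s ^+ 2 * (1 - 2 / (n%:R - (size s)%:R)) + 1.
Proof.
move=> sn ps.
have n_s : n%:R - (size s)%:R != 0 :> R.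
  by rewrite subr_eq0 eqr_nat neq_ltn sn orbT.
(* Drawing [f] moves the gap by 1, drawing [g] by -1, and any other program leaves it unchanged. *)
have -> : \sum_x q s x * gap (rcons s x) ^+ 2 =
    gap s ^+ 2 + 2 * gap s * (q s f - q s g) + (q s f + q s g).
  rewrite (bigD1 f) //= (bigD1 g) /=; last by rewrite eq_sym.
  rewrite !gap_rcons !eqxx (negPf f_neq_g) [g == f]eq_sym (negPf f_neq_g).
  under eq_bigr => x /andP[/negPf xf /negPf xg].
    by rewrite gap_rcons xf xg subrr addr0; over.
  rewrite -mulr_suml; have := sum_block sn ps.
  rewrite (bigD1 f) //= (bigD1 g) /=; last by rewrite eq_sym.
  set z := (X in _ + (_ + X)); move=> e.
  have zE : z = 1 - q s f - q s g by rewrite -e; ring.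
  rewrite [\sum_(i | _) _]zE.
  by ring.
have -> : q s f - q s g = - (gap s / (n%:R - (size s)%:R)).
  by rewrite !blockE // /gap; field.
have := sum_block sn ps.
rewrite (bigD1 f) //= (bigD1 g) /=; last by rewrite eq_sym.
have : 0 <= \sum_(x | (x != f) && (x != g)) q s x.
  by apply: sumr_ge0 => x _; apply: block_ge0.
set z := \sum_(x | _) _ => z0 e.
have qle : q s f + q s g <= 1 by rewrite -e; lra.
apply: le_trans (lerD (lexx _) qle) _.
by rewrite le_eqVlt; apply/orP; left; apply/eqP; field.
Qed.

(** The bound reproduces itself under the one-step recursion: (n - i)(1 - 2 / (n - i)) + 1 = n - (i
    + 1). *)
Lemma gap_second_moment (i : nat) : (i < n)%N ->
  \sum_(s : i.-tuple prog) p s * gap s ^+ 2 <= n%:R - i%:R.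
Proof.
elim: i => [_|i IH i_n].
  rewrite (big_pred1 [tuple]) => [|t]; last by rewrite [t]tuple0 /= eqxx.
  by rewrite /gap /= subrr expr0n mulr0 subr0.
rewrite (sum_urn_succ (fun s => gap s ^+ 2)) 1?ltnW //.
(* This keeps the contraction factor nonnegative, so that the induction hypothesis may be multiplied
   by it. The strict inequality [i.+1 < n] provides it. *)
have n_i : 2 <= n%:R - i%:R :> R.
  by rewrite lerBrDr -natrD ler_nat addnC addn2.
apply: (@le_trans _ _ (\sum_(s : i.-tuple prog)
    (p s * gap s ^+ 2 * (1 - 2 / (n%:R - i%:R)) + p s))).
  apply: ler_sum => s _; have [->|ps] := eqVneq (p s) 0.
    by rewrite !mul0r addr0.
  have := @gap_second_moment_step s; rewrite size_tuple => /(_ (ltnW i_n) ps).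
  by move=> /(ler_wpM2l (p_ge0 s)); rewrite mulrDr mulr1 mulrA.
rewrite big_split /= -mulr_suml sum_urn; last by do 2 apply: ltnW.
have := IH (ltnW i_n); set V := \sum_(s : _) _ => VI.
have h : 0 <= 1 - 2 / (n%:R - i%:R) :> R.
  by rewrite subr_ge0 ler_pdivrMr ?mul1r //; lra.
apply: (le_trans (lerD (ler_wpM2r h VI) (lexx _))).
rewrite -natr1 le_eqVlt; apply/orP; left; apply/eqP; field; lra.
Qed.

(* AM-GM: [2 |gap| <= gap^2 / sqrt (n - i) + sqrt (n - i)] *)
Lemma sum_block_diff_le (i : nat) : (i < n)%N ->
  \sum_(s : i.-tuple prog) `|q s f - q s g| * p s <= (Num.sqrt (n - i)%N%:R)^-1.
Proof.
move=> i_n; set r := Num.sqrt _.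
have r_gt0 : 0 < r by rewrite sqrtr_gt0 ltr0n subn_gt0.
have rr : r ^+ 2 = n%:R - i%:R by rewrite sqr_sqrtr // natrB // ltnW.
apply: (@le_trans _ _ (\sum_(s : i.-tuple prog)
    ((2 * r ^+ 3)^-1 * (p s * gap s ^+ 2) + (2 * r)^-1 * p s))).
  apply: ler_sum => s _; have [->|ps] := eqVneq (p s) 0.
    by rewrite mulr0 mul0r !mulr0 addr0.
  have -> : q s f - q s g = - (gap s / r ^+ 2).
    by rewrite !blockE ?size_tuple // -rr /gap; field; rewrite gt_eqF.
  rewrite normrN normrM normfV [X in _ / X]ger0_norm ?sqr_ge0 //.
  (* The slack in AM-GM is an explicit square. The weights are tuned to a second moment of r^2: each
     of the two terms then contributes 1 / (2 r). *)
  have -> : (2 * r ^+ 3)^-1 * (p s * gap s ^+ 2) + (2 * r)^-1 * p s =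
      (`|gap s| / r ^+ 2) * p s + p s * (2 * r ^+ 3)^-1 * (`|gap s| - r) ^+ 2.
    by rewrite -[gap s ^+ 2]real_normK ?num_real //; field; rewrite gt_eqF.
  rewrite lerDl mulr_ge0 ?sqr_ge0 // mulr_ge0 // invr_ge0 mulr_ge0 // exprn_ge0 //.
  exact: ltW.
rewrite big_split /= -!mulr_sumr sum_urn 1?ltnW // mulr1.
have := gap_second_moment i_n; rewrite -rr => V.
have h : 0 <= (2 * r ^+ 3)^-1.
  by rewrite invr_ge0 mulr_ge0 // exprn_ge0 // ltW.
apply: (le_trans (lerD (ler_wpM2l h V) (lexx _))).
by rewrite le_eqVlt; apply/orP; left; apply/eqP; field; rewrite gt_eqF.
Qed.

End Urn.

(** After reversal of the index, each term satisfies 1 / sqrt (j + 1) <= 2 (sqrt (j + 1) - sqrt j),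
    and the sum telescopes. *)
Lemma sum_inv_sqrt_le (R : realType) (n : nat) :
  \sum_(i < n) (Num.sqrt (n - i)%N%:R)^-1 <= 2 * Num.sqrt n%:R :> R.
Proof.
rewrite (reindex_inj rev_ord_inj) /=.
have -> : \sum_(j < n) (Num.sqrt (n - (n - j.+1))%N%:R)^-1 =
    \sum_(j < n) (Num.sqrt j.+1%:R)^-1 :> R.
  by apply: eq_bigr => j _; rewrite subKn.
elim: n => [|n IH]; first by rewrite big_ord0 mulr_ge0.
rewrite big_ord_recr /=; apply: (le_trans (lerD IH (lexx _))).
set x := Num.sqrt n%:R; set y := Num.sqrt n.+1%:R.
have y_gt0 : 0 < y by rewrite sqrtr_gt0.
have x_ge0 : 0 <= x by rewrite sqrtr_ge0.
have e : y ^+ 2 = x ^+ 2 + 1 by rewrite !sqr_sqrtr // natr1.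
(* What remains is 2xy + 1 <= 2y^2, which is (y - x)^2 >= 0 because y^2 = x^2 + 1. *)
rewrite -(ler_pM2r y_gt0) mulrDl mulVf ?gt_eqF //; nra.
Qed.

(** * Integrals and equality of laws *)

(** A common setting for all transfers of integrals below: restricted to [D1], [Y1] has [k] times
    the law of [Y2] restricted to [D2]. The factor [k] will be a draw probability, the probability
    of a program at a run, or 1 for convolutions. *)
Section IntegralLaw.
Context {R : realType} {d1 d2 d' : measure_display} {T1 : measurableType d1}
  {T2 : measurableType d2} {T' : measurableType d'}.
Variables (mu1 : {measure set T1 -> \bar R}) (mu2 : {measure set T2 -> \bar R}).
Variables (D1 : set T1) (D2 : set T2) (Y1 : T1 -> T') (Y2 : T2 -> T') (k : R).
Hypotheses (mD1 : measurable D1) (mD2 : measurable D2).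
Hypotheses (mY1 : measurable_fun setT Y1) (mY2 : measurable_fun setT Y2).
Hypotheses (k_ge0 : 0 <= k)
  (law : forall C, measurable C ->
    mu1 (D1 `&` Y1 @^-1` C) = (k%:E * mu2 (D2 `&` Y2 @^-1` C))%E).

Let measurable_mark d (T : measurableType d) (D : set T) (Y : T -> T') :
  measurable D -> measurable_fun setT Y ->
  measurable_fun setT (fun w => (w \in D, Y w)).
Proof.
move=> mD mY; apply/measurable_fun_pairP; split => //=.
apply: (measurable_fun_bool true) => /=.
rewrite setTI (_ : _ @^-1` _ = D) //.
by apply/seteqP; split => w /=; [exact: set_mem|exact: mem_set].
Qed.

Let kn : {nonneg R} := NngNum k_ge0.

(* Recording membership in [D] as a first coordinate turns the restriction of
   [mu] to [D] into the restriction of an image measure to [{true} * T']. *)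
Lemma ge0_integral_law (h : T' -> \bar R) :
  measurable_fun setT h -> (forall y, 0 <= h y)%E ->
  (\int[mu1]_(w in D1) h (Y1 w) = k%:E * \int[mu2]_(w in D2) h (Y2 w))%E.
Proof.
move=> mh h_ge0.
pose S := [set true] `*` [set: T'].
have mS : measurable S by exact: measurableX.
have mhS : measurable_fun S (h \o snd).
  by apply: measurable_funTS; apply: measurableT_comp.
have mark_preimage d (T : measurableType d) (D : set T) (Y : T -> T') A :
    A `<=` S -> (fun w => (w \in D, Y w)) @^-1` A =
      D `&` Y @^-1` [set y | A (true, y)].
  move=> AS; apply/seteqP; split => w /=; last by case => /mem_set ->.
  move=> Aw; have [/= e _] := AS _ Aw.
  by rewrite e in Aw; split => //; rewrite -in_setE.
have pull d (T : measurableType d) (mu : {measure set T -> \bar R})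
    (D : set T) (Y : T -> T') : measurable D -> measurable_fun setT Y ->
  (\int[mu]_(w in D) h (Y w) =
   \int[pushforward mu (fun w => (w \in D, Y w))]_(z in S) (h \o snd) z)%E.
  move=> mD mY; rewrite (ge0_integral_pushforward (measurable_mark mD mY)) //;
    last by move=> y _; exact: h_ge0.
  rewrite mark_preimage //; congr integral.
  by apply/seteqP; split => w /=; [|case].
have mh2 : measurable_fun D2 (fun w => h (Y2 w)).
  by apply: measurable_funTS; exact: measurableT_comp.
rewrite -[k]/(kn%:num) -(ge0_integral_mscale mu2 mD2 kn mh2) //.
rewrite (pull _ _ mu1 D1) // (pull _ _ (mscale kn mu2) D2) //.
have m1 := measurable_mark mD1 mY1; have m2 := measurable_mark mD2 mY2.
pose law1 := measure_function_pushforward__canonical__measure_function_Measure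
  mu1 m1.
pose law2 := measure_function_pushforward__canonical__measure_function_Measure
  (mscale kn mu2) m2.
have law12 A : measurable A -> A `<=` S -> law1 A = law2 A.
  move=> mA AS; rewrite /law1 /law2 /= /pushforward !mark_preimage //=.
  rewrite /mscale law //.
  have := measurable_xsection true mA.
  rewrite (_ : xsection _ _ = [set y | A (true, y)]) //; apply/seteqP.
  by split => y; rewrite /xsection /=; [exact: set_mem|exact: mem_set].
exact: (eq_measure_integral (D := S) (f := h \o snd) law2 law12).
Qed.

Lemma integrable_law (h : T' -> R) :
  measurable_fun setT h -> mu2.-integrable D2 (EFin \o (h \o Y2)) ->
  mu1.-integrable D1 (EFin \o (h \o Y1)).
Proof.
move=> mh /integrableP[_ fin2]; apply/integrableP; split.
  by apply/measurable_EFinP/measurable_funTS; exact: measurableT_comp.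
have m_abs : measurable_fun setT (fun y => `|(h y)%:E|%E).
  by apply: measurableT_comp => //; exact/measurable_EFinP.
have abs_ge0 y : (0 <= `|(h y)%:E|)%E by exact: abse_ge0.
have := @ge0_integral_law (fun y => `|(h y)%:E|%E) m_abs abs_ge0.
move=> /= ->; exact: lte_mul_pinfty.
Qed.

Lemma Rintegral_law (h : T' -> R) :
  measurable_fun setT h -> mu2.-integrable D2 (EFin \o (h \o Y2)) ->
  \int[mu1]_(w in D1) h (Y1 w) = k * \int[mu2]_(w in D2) h (Y2 w).
Proof.
move=> mh ih; rewrite /Rintegral.
have mEh : measurable_fun setT (EFin \o h) by exact/measurable_EFinP.
have ihf := integrable_fin_num mD2 ih.
suff -> : (\int[mu1]_(w in D1) (h (Y1 w))%:E
    = k%:E * \int[mu2]_(w in D2) (h (Y2 w))%:E)%E by rewrite fineM.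
(* The nonnegative case is applied to the positive and negative parts; their finiteness lets [k]
   distribute over the difference. *)
rewrite integralE [in RHS]integralE.
have pos := integrable_pos_fin_num mD2 ih.
have neg := integrable_neg_fin_num mD2 ih.
rewrite muleBr //; last by rewrite fin_num_adde_defl // fin_numN.
have lawp := @ge0_integral_law ((EFin \o h)^\+)%E (measurable_funepos mEh)
  (fun=> funepos_ge0 _ _).
have lawn := @ge0_integral_law ((EFin \o h)^\-)%E (measurable_funeneg mEh)
  (fun=> funeneg_ge0 _ _).
rewrite !funepos.unlock !funeneg.unlock in lawp lawn *.
by congr (_ - _)%E; [exact: lawp|exact: lawn].
Qed.

End IntegralLaw.

Section AeBounded.
Context {R : realType} {d : measure_display} {T : measurableType d}
  (P : probability T R).

Lemma integrable_ae_bounded (D : set T) (h : T -> R) (M : R) :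
  measurable D -> measurable_fun setT h -> {ae P, forall w, `|h w| <= M} ->
  P.-integrable D (EFin \o h).
Proof.
move=> mD mh hM.
have mEh : measurable_fun D (EFin \o h).
  by apply/measurable_EFinP; exact: measurable_funTS.
apply/integrableP; split => //.
apply: (@le_lt_trans _ _ (`|M|%:E * P D)%E).
  apply: integral_le_bound => //.
  by apply: filterS hM => w hw _; rewrite /= lee_fin (le_trans hw) ?ler_norm.
by rewrite lte_mul_pinfty // (le_lt_trans (probability_le1 P mD)) // ltry.
Qed.

Lemma Rintegral_ae_bounded (D : set T) (h : T -> R) (M : R) :
  measurable D -> measurable_fun setT h -> {ae P, forall w, `|h w| <= M} ->
  `|\int[P]_(w in D) h w| <= `|M| * fine (P D).
Proof.
move=> mD mh hM.
have ih := integrable_ae_bounded mD mh hM.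
have fP : P D \is a fin_num by exact: fin_num_measure.
rewrite -lee_fin EFin_normr_Rintegral // EFinM fineK //.
have mEh : measurable_fun D (EFin \o h).
  by apply/measurable_EFinP; exact: measurable_funTS.
apply: le_trans (le_abse_integral _ mD mEh) _.
apply: integral_le_bound => //.
by apply: filterS hM => w hw _; rewrite /= lee_fin (le_trans hw) ?ler_norm.
Qed.

End AeBounded.

Lemma Rintegral_sum {R : realType} d (T : measurableType d)
    (mu : {measure set T -> \bar R}) (D : set T) (I : Type) (r : seq I)
    (h : I -> T -> R) :
  measurable D -> (forall k, mu.-integrable D (EFin \o h k)) ->
  \int[mu]_(w in D) (\sum_(k <- r) h k w) = \sum_(k <- r) \int[mu]_(w in D) h k w.
Proof.
move=> mD ih; rewrite /Rintegral.
under eq_integral do rewrite -sumEFin.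
rewrite integral_sum // -sum_fine // => k _; exact: (integrable_fin_num mD (ih k)).
Qed.

Lemma Rintegral_partition {R : realType} d (T : measurableType d)
    (P : probability T R) (D : set T) (I : finType) (E : I -> set T) (h : T -> R) :
  measurable D -> (forall k, measurable (E k)) ->
  (forall w, exists! k, E k w) -> P.-integrable setT (EFin \o h) ->
  \int[P]_(w in D) h w = \sum_k \int[P]_(w in D `&` E k) h w.
Proof.
move=> mD mE part ih.
under eq_bigr do rewrite Rintegral_mkcondr.
rewrite -Rintegral_sum //; last first.
  move=> k; apply: (integrableS measurableT mD (@subsetT _ D)).
  have := (integrable_mkcond (EFin \o h) (mE k)).1.
  rewrite restrict_EFin; apply; exact: integrableS ih.
apply: eq_Rintegral => w _.
have [k [Ek uniq]] := part w.
(* At each point exactly one piece of the partition contributes. *)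
rewrite (bigD1 k) //= patchE mem_set // big1 ?addr0 // => j jk.
rewrite patchE memNset // => Ej; move: jk; rewrite (uniq _ Ej) eqxx //.
Qed.

Lemma measurable_norm_le {R : realType} (A : R) :
  measurable [set t : R | `|t| <= A].
Proof.
rewrite (_ : [set _ | _] = setT `&` (fun t : R => `|t|) @^-1` `]-oo, A]).
  by apply: (@normr_measurable R setT); [exact: measurableT|exact: measurable_itv].
by rewrite setTI; apply/seteqP; split => t /=; rewrite in_itv.
Qed.

Lemma measurable_norm_gt {R : realType} (A : R) :
  measurable [set t : R | A < `|t|].
Proof.
rewrite (_ : [set _ | _] = setT `&` (fun t : R => `|t|) @^-1` `]A, +oo[).
  by apply: (@normr_measurable R setT); [exact: measurableT|exact: measurable_itv].
by rewrite setTI; apply/seteqP; split => t /=; rewrite in_itv /= andbT.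
Qed.

(** The separation behind every essential bound below: a summand within A cannot bring one beyond
    |M| + A back to within M. *)
Lemma norm_add_gt {R : realDomainType} (M A s t : R) :
  `|s| <= A -> `|M| + A < `|t| -> ~ `|s + t| <= M.
Proof.
move=> sA tM stM; have := ler_normD (s + t) (- s).
by rewrite addrC addKr normrN => tst; have := ler_norm M; lra.
Qed.

(** * Runs of an experiment *)

Section Run.
Context {R : realType} {prog : finType} {config : Type} {d : measure_display}
  {state : measurableType d}.
Variables (e : effects R prog config state) (c : config)
  (X : experiment R prog state).

Local Notation P := (Pr X).

Lemma history_measurable a b k A : history X a b k A -> measurable A.
Proof.
move: A; apply: smallest_sub; first exact: sigma_algebra_measurable.
move=> A [[i [f [_ ->]]]|[[i [B [_ mB ->]]]|[i [B [_ mB ->]]]]].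
- exact: program_measurable.
- by rewrite -[X in measurable X]setTI; exact: measurable_funP.
- by rewrite -[X in measurable X]setTI; exact: measurable_funP.
Qed.

Lemma historyI a b k A B :
  history X a b k A -> history X a b k B -> history X a b k (A `&` B).
Proof.
rewrite /history; set G := (X in <<s X >>) => hA hB.
exact: (@measurableI _ (g_sigma_algebraType G)).
Qed.

Lemma history_program a b k i f : (i < a)%N ->
  history X a b k [set w | program X i w = f].
Proof. by move=> ia; apply: sub_sigma_algebra; left; exists i, f. Qed.

Lemma history_state a b k i B : (i < b)%N -> measurable B ->
  history X a b k (state_at X i @^-1` B).
Proof. by move=> ib mB; apply: sub_sigma_algebra; right; left; exists i, B. Qed.

(** These events are the atoms of the sigma-algebra generated by the first [size s] programs, so
    conditioning on past programs becomes a finite sum over them. *)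
Definition past_event (s : seq prog) : set (Omega X) :=
  [set w | past_programs X (size s) w = s].

Lemma past_event_rcons s x :
  past_event (rcons s x) = past_event s `&` [set w | program X (size s) w = x].
Proof.
rewrite /past_event size_rcons; apply/seteqP; split => w /=.
  by rewrite /past_programs mkseqS => /rcons_inj [].
by rewrite /past_programs mkseqS => -[-> ->].
Qed.

Lemma history_past a b k s : (size s <= a)%N -> history X a b k (past_event s).
Proof.
elim/last_ind: s => [_|s x IH].
  rewrite /past_event /= (_ : [set _ | _] = setT); last by apply/seteqP; split.
  exact: (@measurableT _ (g_sigma_algebraType _)).
rewrite size_rcons => sa; rewrite past_event_rcons.
by apply: historyI; [apply: IH; exact: ltnW|exact: history_program].
Qed.

Lemma past_event_measurable s : measurable (past_event s).
Proof. exact: (history_measurable (@history_past _ 0 0 _ (leqnn _))). Qed.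

Lemma past_event_partition i w : exists! s : i.-tuple prog, past_event s w.
Proof.
have sz : size (past_programs X i w) == i by rewrite size_mkseq.
exists (Tuple sz); rewrite /past_event /=; split; first by rewrite size_mkseq.
move=> s; rewrite size_tuple => e0; exact: val_inj.
Qed.

Variables (q : design R prog) (n : nat).
Hypotheses (Xdesign : program_design q n X) (Xadditive : additive_effect e c n X).

(** The history in [program_design] contains the state of the current run, so the event on that
    state may be included in the conditioning. The conditional probability is constant on
    [past_event s], which yields the independence of program and state given the past programs. *)
Lemma past_program_law s x C : (size s < n)%N -> measurable C ->
  P (past_event (rcons s x) `&` state_at X (size s) @^-1` C) =
  ((q s x)%:E * P (past_event s `&` state_at X (size s) @^-1` C))%E.
Proof.
move=> sn mC; have [[_ cp] _] := Xdesign x sn.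
have hA : history X (size s) (size s).+1 (size s)
    (past_event s `&` state_at X (size s) @^-1` C).
  by apply: historyI; [exact: history_past|exact: history_state].
rewrite past_event_rcons setIAC cp //.
rewrite (eq_integral (cst (q s x)%:E)) => [|w /set_mem [/= -> _] //].
by rewrite integral_cst //; exact: history_measurable hA.
Qed.

Lemma past_prob_rcons s x : (size s < n)%N ->
  P (past_event (rcons s x)) = ((q s x)%:E * P (past_event s))%E.
Proof.
by move=> sn; have := past_program_law x sn measurableT; rewrite preimage_setT !setIT.
Qed.

Lemma noise_cond_law i A B : (i < n)%N -> history X i.+1 i.+1 i A -> measurable B ->
  P (A `&` noise_at X i @^-1` B) = (\int[P]_(w in A) noise_law e c (state_at X i w) B)%E.
Proof.
move=> i_n hA mB; have [_ /(_ setT B measurableT mB) [_ /(_ _ hA)]] := Xadditive i_n.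
rewrite preimage_setT setTI => ->.
by apply: eq_integral => w _; rewrite probability_setT mul1e.
Qed.

(* Given the past programs, the noise depends on the state only, and the state
   is independent of the next program. *)
Lemma past_noise_law s x B : 0 <= q s x -> (size s < n)%N -> measurable B ->
  P (past_event (rcons s x) `&` noise_at X (size s) @^-1` B) =
  ((q s x)%:E * P (past_event s `&` noise_at X (size s) @^-1` B))%E.
Proof.
move=> q0 sn mB; rewrite !noise_cond_law //; last 2 first.
- by apply: history_past.
- by apply: history_past; rewrite size_rcons.
have mU : measurable_fun setT (state_at X (size s)) by exact: measurable_funP.
(* The law of the state transfers with factor [q s x]; integrating the noise kernel against it gives
   the law of the noise. *)
exact: (ge0_integral_law (past_event_measurable _) (past_event_measurable _)
  mU mU q0 (fun C => @past_program_law s x C sn) (h := fun u => noise_law e c u B)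
  (measurable_kernel _ _ mB) (fun u => measure_ge0 _ _)).
Qed.

Lemma Rintegral_past_noise s x : 0 <= q s x -> (size s < n)%N ->
  P.-integrable setT (EFin \o noise_at X (size s)) ->
  \int[P]_(w in past_event (rcons s x)) noise_at X (size s) w =
  q s x * \int[P]_(w in past_event s) noise_at X (size s) w.
Proof.
move=> q0 sn ih.
have mN : measurable_fun setT (noise_at X (size s)) by exact: measurable_funP.
apply: (Rintegral_law (past_event_measurable _) (past_event_measurable _)
  mN mN q0 (fun C => @past_noise_law s x C q0 sn) (h := id)) => //.
by apply: integrableS ih => //; exact: past_event_measurable.
Qed.

Lemma Rintegral_program_noise i x : (i < n)%N -> (forall s, 0 <= q s x) ->
  P.-integrable setT (EFin \o noise_at X i) ->
  \int[P]_(w in [set w | program X i w = x]) noise_at X i w =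
  \sum_(s : i.-tuple prog) q s x * \int[P]_(w in past_event s) noise_at X i w.
Proof.
move=> i_n q0 ih.
rewrite (Rintegral_partition (E := fun s : i.-tuple prog => past_event s)) //.
- apply: eq_bigr => s _; have := @Rintegral_past_noise s x.
  by rewrite past_event_rcons size_tuple setIC; apply.
- exact: program_measurable.
- by move=> s; exact: past_event_measurable.
- exact: past_event_partition.
Qed.

(** With the noise event taken to be everything, its factor is 1, and the remaining factor is
    constant on the event that the program is [x]. *)
Lemma true_time_cond_law i x A : (i < n)%N -> measurable A ->
  P ([set w | program X i w = x] `&` true_time_at X i @^-1` A) =
  (P [set w | program X i w = x] * true_time_law e c x A)%E.
Proof.
move=> i_n mA.
have hx := @history_program i.+1 i.+1 i i x (ltnSn i).
have [_ /(_ A setT mA measurableT) [_ /(_ _ hx)]] := Xadditive i_n.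
rewrite preimage_setT setIT => ->.
rewrite (eq_integral (cst (true_time_law e c x A))); last first.
  by move=> w /set_mem /= ->; rewrite prob_kernel mule1.
by rewrite integral_cst 1?muleC //; exact: program_measurable.
Qed.

Lemma Rintegral_true_time i x : (i < n)%N ->
  (true_time_law e c x).-integrable setT (EFin \o id) ->
  \int[P]_(w in [set w | program X i w = x]) true_time_at X i w =
  fine (P [set w | program X i w = x]) * \int[true_time_law e c x]_t t.
Proof.
move=> i_n ih; have mx := @program_measurable _ _ _ _ X i x.
have mT : measurable_fun setT (true_time_at X i) by exact: measurable_funP.
have p_ge0 : 0 <= fine (P [set w | program X i w = x]) by exact: fine_ge0.
apply: (Rintegral_law mx measurableT mT (@measurable_id _ _ _) p_ge0 _ (h := id)) => //.
move=> C mC; apply: etrans (true_time_cond_law x i_n mC) _.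
by rewrite setTI fineK // fin_num_measure.
Qed.

Lemma noise_ae_bounded (M A : R) i : (i < n)%N -> bounded_times M n X ->
  (forall x, 0 < true_time_law e c x [set t | (`|t| <= A)%R])%E ->
  {ae P, forall w, `|noise_at X i w| <= `|M| + A}.
Proof.
move=> i_n XM pA.
have [Tsum XA] := Xadditive i_n.
pose small : set R := [set t | `|t| <= A].
pose large : set R := [set t | `|M| + A < `|t|].
have msmall : measurable small by exact: measurable_norm_le.
have mlarge : measurable large by exact: measurable_norm_gt.
have mT : measurable (true_time_at X i @^-1` small).
  by rewrite -[X in measurable X]setTI; exact: measurable_funP.
have mN : measurable (noise_at X i @^-1` large).
  by rewrite -[X in measurable X]setTI; exact: measurable_funP.
(* The true-time law depends on the program, so the programs are treated one at a time; finitely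
   many null sets remain to be discarded. *)
suff null x : P ([set w | program X i w = x] `&` noise_at X i @^-1` large) = 0%E.
  have /filter_forall : forall x, \forall w \ae P,
      ~ ([set w | program X i w = x] `&` noise_at X i @^-1` large) w.
    move=> x; exists ([set w | program X i w = x] `&` noise_at X i @^-1` large).
    split => //; last by move=> w /= /contrapT.
    by apply: measurableI => //; exact: program_measurable.
  apply: filterS => w /(_ (program X i w)) /= h.
  by rewrite leNgt; apply/negP => lt; apply: h.
have hx := @history_program i.+1 i.+1 i i x (ltnSn i).
have mx := @program_measurable _ _ _ _ X i x.
have : P ([set w | program X i w = x] `&`
    (true_time_at X i @^-1` small `&` noise_at X i @^-1` large)) = 0%E.
  have /= [N [mN' N0 subN]] := XM i i_n.
  apply: subset_measure0 N0 => //; first by do 2 apply: measurableI => //.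
  move=> w [_ [/= s l]]; apply: subN => /=.
  by rewrite Tsum; exact: norm_add_gt s l.
have [_ /(_ small large msmall mlarge) [_ /(_ _ hx) ->]] := Xadditive i_n.
(* For a fixed program the small true time is a constant positive factor, so the vanishing of the
   product forces the other factor, the probability of large noise, to vanish. *)
rewrite (eq_integral (fun w => true_time_law e c x small *
  noise_law e c (state_at X i w) large)%E); last by move=> w /set_mem /= ->.
rewrite ge0_integralZl //; last first.
  apply: measurable_funTS.
  exact: (measurableT_comp (measurable_kernel _ _ mlarge)).
rewrite -noise_cond_law // => /eqP; rewrite mule_eq0 => /orP[|/eqP //].
by rewrite gt_eqF.
Qed.

End Run.

Arguments past_event {R prog d state} X s _.

(** * The true delta *)

(** The value of a kernel at a point comes as a measure with a proof of total mass 1; this alias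
    packs it as a [probability], the form that section [Convolution] takes. *)
Definition unit_measure {R : realType} {d} {T : measurableType d}
    (mu : {measure set T -> \bar R}) & mu setT = 1%E : set T -> \bar R := mu.

HB.instance Definition _ {R : realType} {d} {T : measurableType d}
    (mu : {measure set T -> \bar R}) (mu1 : mu setT = 1%E) :=
  Measure.on (unit_measure mu1).

HB.instance Definition _ {R : realType} {d} {T : measurableType d}
    (mu : {measure set T -> \bar R}) (mu1 : mu setT = 1%E) :=
  Measure_isProbability.Build _ _ _ (unit_measure mu1) mu1.

Lemma probability_of_measure {R : realType} {d} {T : measurableType d}
    (mu : {measure set T -> \bar R}) :
  mu setT = 1%E -> exists p : probability T R, p = mu :> (set T -> \bar R).
Proof. by move=> mu1; exists (unit_measure mu1). Qed.

(** The balls exhaust the line, so they cannot all be null. This is the origin of the constant A. *)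
Lemma exists_norm_le_gt0 {R : realType} (mu : probability R R) :
  exists k : nat, (0 < mu [set t | (`|t| <= k%:R)%R])%E.
Proof.
apply: contrapT => /forallNP null.
have : mu.-negligible (\bigcup_k [set t : R | `|t| <= k%:R]).
  apply: negligible_bigcup => k; apply/negligibleP.
    exact: measurable_norm_le.
  by apply/eqP; rewrite -measure_le0 leNgt; apply/negP/null.
rewrite (_ : \bigcup_k _ = setT); last first.
  apply/seteqP; split => // t _; exists (Num.trunc `|t|).+1 => //=.
  by apply/ltW/truncnS_gt.
move=> /negligibleP -/(_ measurableT) mu0.
have /eqP := etrans (esym (probability_setT mu)) mu0.
by rewrite onee_eq0.
Qed.

Lemma exists_norm_le_gt0_fin {R : realType} {I : finType}
    (mu : I -> probability R R) :
  exists k : nat, forall x, (0 < mu x [set t | (`|t| <= k%:R)%R])%E.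
Proof.
have /choice[k mu_gt0] x := exists_norm_le_gt0 (mu x).
exists (\max_x k x)%N => x; apply: lt_le_trans (mu_gt0 x) _.
apply: le_measure; rewrite ?inE; try exact: measurable_norm_le.
by move=> t /= /le_trans; apply; rewrite ler_nat leq_bigmax.
Qed.

(** * Essential bounds and mean of the factors of a convolution *)

Section Convolution.
Context {R : realType} (mu nu lam : probability R R) (M A : R).
Hypothesis lamE : forall B, measurable B ->
  lam B = (mu \x nu)%E [set x | B (x.1 + x.2)].
Hypotheses (lamM : {ae lam, forall t, `|t| <= M})
  (mu_gt0 : (0 < mu [set t | (`|t| <= A)%R])%E).

Let lam_large : lam [set t | M < `|t|] = 0%E.
Proof.
apply/negligibleP; first exact: measurable_norm_gt.
have [N [mN N0 subN]] := lamM; exists N; split => // t /= Mt; apply: subN => /=.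
by apply/negP; rewrite -ltNge.
Qed.

Let measurable_add : measurable_fun setT (fun x : R * R => x.1 + x.2).
Proof. by apply: measurable_funD; [exact: measurable_fst|exact: measurable_snd]. Qed.

Let rect_null (B C : set R) : measurable B -> measurable C ->
  (forall s t, B s -> C t -> M < `|s + t|) -> (mu B * nu C)%E = 0%E.
Proof.
move=> mB mC BC; rewrite -product_measure1E //.
move: lam_large; rewrite lamE; last exact: measurable_norm_gt.
apply: subset_measure0; first exact: measurableX.
  rewrite -[X in measurable X]setTI.
  exact: (measurable_add measurableT (measurable_norm_gt M)).
by move=> [s t] [/= Bs Ct]; exact: BC.
Qed.

Lemma conv_right_ae_bounded : {ae nu, forall t, `|t| <= `|M| + A}.
Proof.
exists [set t | `|M| + A < `|t|]; split; first exact: measurable_norm_gt; last first.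
  by move=> t /= /negP; rewrite -ltNge.
have : (mu [set t | (`|t| <= A)%R] * nu [set t | (`|M| + A < `|t|)%R])%E = 0%E.
  apply: rect_null; [exact: measurable_norm_le|exact: measurable_norm_gt|].
  by move=> s t /= sA tM; rewrite ltNge; apply/negP; exact: norm_add_gt sA tM.
by move=> /eqP; rewrite mule_eq0 gt_eqF // => /eqP.
Qed.

(** The roles are exchanged: the right factor, now known to be bounded by |M| + A, gives that ball
    mass 1, and it serves as the small summand. *)
Lemma conv_left_ae_bounded : {ae mu, forall t, `|t| <= `|M| + (`|M| + A)}.
Proof.
exists [set t | `|M| + (`|M| + A) < `|t|]; split; first exact: measurable_norm_gt;
  last by move=> t /= /negP; rewrite -ltNge.
have : (mu [set t | (`|M| + (`|M| + A) < `|t|)%R] *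
    nu [set t | (`|t| <= `|M| + A)%R])%E = 0%E.
  apply: rect_null; [exact: measurable_norm_gt|exact: measurable_norm_le|].
  move=> s t /= sM tA; rewrite ltNge addrC; apply/negP; exact: norm_add_gt tA sM.
have -> : nu [set t | (`|t| <= `|M| + A)%R] = 1%E.
  have [N [mN N0 subN]] := conv_right_ae_bounded.
  have mS := measurable_norm_le (`|M| + A).
  have nuSC : nu (~` [set t | (`|t| <= `|M| + A)%R]) = 0%E.
    by apply: subset_measure0 N0 => //; exact: measurableC.
  have := probability_setC nu (measurableC mS).
  by rewrite setCK nuSC sube0.
by rewrite mule1.
Qed.

Lemma Rintegral_conv :
  \int[lam]_t t = \int[mu]_t t + \int[nu]_t t.
Proof.
have imu : mu.-integrable setT (EFin \o id).
  exact: integrable_ae_bounded conv_left_ae_bounded.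
have inu : nu.-integrable setT (EFin \o id).
  exact: integrable_ae_bounded conv_right_ae_bounded.
have mid : measurable_fun setT (@id R) by exact: measurable_id.
have mf : measurable_fun setT (@fst R R) by exact: measurable_fst.
have ms : measurable_fun setT (@snd R R) by exact: measurable_snd.
(* The two marginals of the product and the law of the sum are three instances of the transfer of
   integrals with factor 1. *)
have law1 C : measurable C ->
    (mu \x nu)%E (setT `&` fst @^-1` C) = (1%:E * mu (setT `&` id @^-1` C))%E.
  move=> mC; rewrite !setTI mul1e (_ : fst @^-1` C = C `*` setT).
    by rewrite product_measure1E // [X in (_ * X)%E](probability_setT nu) mule1.
  by apply/seteqP; split => -[s t] //= -[].
have law2 C : measurable C ->
    (mu \x nu)%E (setT `&` snd @^-1` C) = (1%:E * nu (setT `&` id @^-1` C))%E.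
  move=> mC; rewrite !setTI mul1e (_ : snd @^-1` C = setT `*` C).
    by rewrite product_measure1E // [X in (X * _)%E](probability_setT mu) mul1e.
  by apply/seteqP; split => -[s t] //= -[].
have law3 C : measurable C -> lam (setT `&` id @^-1` C) =
    (1%:E * (mu \x nu)%E (setT `&` (fun x => (x.1 + x.2)%R) @^-1` C))%E.
  by move=> mC; rewrite !setTI mul1e -lamE.
have i1 := integrable_law measurableT measurableT mf mid ler01 law1 mid imu.
have i2 := integrable_law measurableT measurableT ms mid ler01 law2 mid inu.
have e1 := Rintegral_law measurableT measurableT mf mid ler01 law1 mid imu.
have e2 := Rintegral_law measurableT measurableT ms mid ler01 law2 mid inu.
have isum : (mu \x nu)%E.-integrable setT
    (EFin \o (id \o (fun x : R * R => x.1 + x.2))).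
  exact: (integrableD measurableT i1 i2).
have e3 := Rintegral_law measurableT measurableT mid measurable_add ler01 law3 mid isum.
rewrite mul1r in e1; rewrite mul1r in e2; rewrite mul1r in e3.
by rewrite -e1 -e2 [LHS]e3 /=; exact: RintegralD.
Qed.

End Convolution.

Lemma measurable_kernel_integral {R : realType} {d} {T : measurableType d}
    (k : R.-pker T ~> R) :
  measurable_fun setT (fun u => \int[k u]_t t%:E)%E.
Proof.
under eq_fun do rewrite integralE.
have mE : measurable_fun setT (@EFin R) by exact: EFin_measurable.
apply: emeasurable_funB; apply: measurable_fun_integral_kernel.
- by move=> U mU; exact: measurable_kernel.
- by move=> z; exact: funepos_ge0.
- exact: measurable_funepos.
- by move=> U mU; exact: measurable_kernel.
- by move=> z; exact: funeneg_ge0.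
- exact: measurable_funeneg.
Qed.

Lemma measurable_kernel_mean {R : realType} {d} {T : measurableType d}
    (k : R.-pker T ~> R) :
  measurable_fun setT (fun u => \int[k u]_t t).
Proof. by apply: measurableT_comp => //; exact: measurable_kernel_integral. Qed.

Lemma ae_exists {R : realType} {d} {T : measurableType d} (P : probability T R)
    (Q : T -> Prop) : {ae P, forall w, Q w} -> exists w, Q w.
Proof.
move=> [N [mN N0 subN]]; apply: contrapT => /forallNP none.
have NT : N = setT by apply/seteqP; split => // w _; apply: subN; exact: none.
have /eqP := etrans (esym (probability_setT P)) (etrans (congr1 P (esym NT)) N0).
by rewrite onee_eq0.
Qed.

(** * Means under the reference distribution *)

Section Reference.
Context {R : realType} {prog : finType} {config : Type} {d : measure_display}
  {state : measurableType d}.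
Variables (m : model R prog config state) (e : effects R prog config state)
  (M A : R) (c : config).
Hypotheses (additive : reference_additive m e c) (bounded : reference_bounded m M c).
Hypothesis true_time_gt0 :
  forall x, (0 < true_time_law e c x [set t | (`|t| <= A)%R])%E.

(** The true-time law does not involve the state, so a single reference state at which additivity
    and the bound both hold is enough. *)
Lemma true_time_ae_bounded x :
  {ae true_time_law e c x, forall t, `|t| <= `|M| + (`|M| + A)}.
Proof.
have [u [add bnd]] : exists u,
    (forall B, measurable B -> time_law m c x u B =
      (true_time_law e c x \x noise_law e c u)%E [set x | B (x.1 + x.2)]) /\
    {ae time_law m c x u, forall t, `|t| <= M}.
  apply: (@ae_exists _ _ _ (ref m c)).
  by near=> u; split; [near: u; exact: additive|near: u; exact: bounded].
have [p pE] := probability_of_measure 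
    (prob_kernel u : time_law m c x u setT = 1%E).
have [q qE] := probability_of_measure 
    (prob_kernel u : noise_law e c u setT = 1%E).
rewrite -pE in add bnd; rewrite -qE in add.
exact: conv_left_ae_bounded add bnd (true_time_gt0 x).
Unshelve. all: by end_near. Qed.

Lemma true_time_integrable x :
  (true_time_law e c x).-integrable setT (EFin \o id).
Proof. exact: integrable_ae_bounded (true_time_ae_bounded x). Qed.

Lemma reference_mean x : {ae ref m c, forall u,
  [/\ (\int[time_law m c x u]_t t%:E)%E \is a fin_num,
      `|\int[time_law m c x u]_t t| <= `|M| &
      \int[time_law m c x u]_t t =
      \int[true_time_law e c x]_t t + \int[noise_law e c u]_t t]}.
Proof.
near=> u.
have add : forall B, measurable B -> time_law m c x u B =
      (true_time_law e c x \x noise_law e c u)%E [set x | B (x.1 + x.2)].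
  by near: u; exact: additive.
have bnd : {ae time_law m c x u, forall t, `|t| <= M}.
  by near: u; exact: bounded.
have [p pE] := probability_of_measure 
    (prob_kernel u : time_law m c x u setT = 1%E).
have [q qE] := probability_of_measure 
    (prob_kernel u : noise_law e c u setT = 1%E).
rewrite -pE in add bnd; rewrite -qE in add.
rewrite /Rintegral -pE -qE.
split; last exact: Rintegral_conv add bnd (true_time_gt0 x).
  apply: (integrable_fin_num measurableT).
  exact: (integrable_ae_bounded measurableT (@measurable_id _ _ _) bnd).
have := Rintegral_ae_bounded measurableT (@measurable_id _ _ setT) bnd.
by rewrite [X in fine X](probability_setT p) /= mulr1.
Unshelve. all: by end_near. Qed.

Lemma true_lossE x :
  true_loss m c x = \int[ref m c]_u \int[time_law m c x u]_t t.
Proof.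
rewrite /true_loss; congr fine; apply: ae_eq_integral => //.
- exact: measurable_kernel_integral.
- by apply/measurable_EFinP; exact: measurable_kernel_mean.
- by apply: filterS (reference_mean x) => u [? _ _] _ /=; rewrite fineK.
Qed.

(** At almost every reference state both programs receive the same noise mean, which cancels inside
    the integral; the integrand left over is constant. *)
Lemma true_deltaE x y : true_delta m c x y =
  \int[true_time_law e c x]_t t - \int[true_time_law e c y]_t t.
Proof.
have int_mean z : (ref m c).-integrable setT
    (EFin \o (fun u => \int[time_law m c z u]_t t)).
  apply: (@integrable_ae_bounded _ _ _ _ _ _ `|M|) => //.
    exact: measurable_kernel_mean.
  by apply: filterS (reference_mean z) => u [].
rewrite /true_delta !true_lossE -RintegralB //.
set k := RHS; transitivity (\int[ref m c]_u k); last first.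
  by rewrite Rintegral_cst // [X in fine X](probability_setT (ref m c)) /= mulr1.
congr fine; apply: ae_eq_integral => //.
- apply/measurable_EFinP; apply: measurable_funB; exact: measurable_kernel_mean.
- near=> u => _; congr EFin.
  have [_ _ ->] : [/\ (\int[time_law m c x u]_t t%:E)%E \is a fin_num,
      `|\int[time_law m c x u]_t t| <= `|M| &
      \int[time_law m c x u]_t t =
      \int[true_time_law e c x]_t t + \int[noise_law e c u]_t t].
    by near: u; exact: reference_mean.
  have [_ _ ->] : [/\ (\int[time_law m c y u]_t t%:E)%E \is a fin_num,
      `|\int[time_law m c y u]_t t| <= `|M| &
      \int[time_law m c y u]_t t =
      \int[true_time_law e c y]_t t + \int[noise_law e c u]_t t].
    by near: u; exact: reference_mean.
  by rewrite /k; ring.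
Unshelve. all: by end_near. Qed.

End Reference.

(** * Bias of the single-block design *)

Section SingleBlock.
Context {R : realType} {prog : finType} {config : Type} {d : measure_display}
  {state : measurableType d}.
Variables (m : model R prog config state) (e : effects R prog config state)
  (M A : R) (c : config) (X : experiment R prog state) (n : nat).
Hypotheses (n_gt0 : (0 < n)%N) (dvdn_card : (#|prog| %| n)%N).
Hypotheses (additive : reference_additive m e c) (bounded : reference_bounded m M c).
Hypothesis true_time_gt0 :
  forall x, (0 < true_time_law e c x [set t | (`|t| <= A)%R])%E.
Hypothesis Xdelta : delta_design m e M c (single_block n) n X.

Local Notation P := (Pr X).
Local Notation runs i x := [set w | program X i w = x].
Local Notation b := (n %/ #|prog|)%N.

Let card_gt0 : (0 < #|prog|)%N. Proof. exact: dvdn_gt0 n_gt0 dvdn_card. Qed.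

Let block_size_neq0 : b%:R != 0 :> R.
Proof. by rewrite pnatr_eq0 -lt0n divn_gt0 // dvdn_leq. Qed.

Let p (s : seq prog) : R := fine (P (past_event X s)).

Let Xadditive : additive_effect e c n X. Proof. by case: Xdelta. Qed.
Let Xbounded : bounded_times M n X. Proof. by case: Xdelta. Qed.
Let Xprogram : program_design (single_block n) n X. Proof. by case: Xdelta. Qed.

Let p_ge0 s : 0 <= p s. Proof. exact: fine_ge0. Qed.

Let p_nil : p [::] = 1.
Proof.
rewrite /p (_ : past_event X [::] = setT); last by apply/seteqP; split.
by rewrite [X in fine X](probability_setT P).
Qed.

Let p_rcons s x : (size s < n)%N -> p (rcons s x) = single_block n s x * p s.
Proof.
move=> sn; rewrite /p (past_prob_rcons Xprogram) // fineM //.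
by apply: fin_num_measure; exact: past_event_measurable.
Qed.

(** Both integrals expand over the same past events, with weights [single_block n s f] and
    [single_block n s g]. The noise integral over each event is at most the noise bound times [p s],
    which leaves the urn estimate. *)
Lemma block_noise_diff_le i f g : (i < n)%N -> f != g ->
  `|\int[P]_(w in runs i f) noise_at X i w - \int[P]_(w in runs i g) noise_at X i w|
  <= `| `|M| + A | / Num.sqrt (n - i)%N%:R.
Proof.
move=> i_n fg.
have bnd := noise_ae_bounded Xadditive i_n Xbounded true_time_gt0.
have mN : measurable_fun setT (noise_at X i) by exact: measurable_funP.
have iN := integrable_ae_bounded measurableT mN bnd.
have q_ge0 x s : 0 <= single_block n s x :> R by exact: block_ge0.
rewrite !(Rintegral_program_noise Xprogram Xadditive) //.
rewrite -sumrB; under eq_bigr do rewrite -mulrBl.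
apply: le_trans (ler_norm_sum _ _ _) _.
apply: (le_trans _ (ler_wpM2l (normr_ge0 _)
  (sum_block_diff_le dvdn_card p_ge0 p_nil p_rcons fg i_n))).
rewrite mulr_sumr; apply: ler_sum => s _; rewrite normrM mulrCA ler_wpM2l //.
by apply: Rintegral_ae_bounded => //; exact: past_event_measurable.
Qed.

Lemma count_runsE i x w :
  count_runs X i x w = (count_mem x (past_programs X i w))%:R.
Proof.
elim: i => [|i IH]; rewrite /count_runs ?big_ord0 //.
rewrite big_ord_recr -/(count_runs X i x w) IH /past_programs mkseqS.
by rewrite -cats1 count_cat /= addn0 natrD.
Qed.

Lemma count_runs_ae x : {ae P, forall w, count_runs X n x w = b%:R}.
Proof.
(* The finitely many sequences of probability 0 are discarded; every other one contains each program
   exactly [b] times. *)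
have /filter_forall : forall s : n.-tuple prog,
    \forall w \ae P, past_event X s w -> p s != 0.
  move=> s; have [p0|_] := eqVneq (p s) 0; last exact: nearW.
  exists (past_event X s); split.
  - exact: past_event_measurable.
  - apply/eqP; rewrite -[X in _ == X]/(0%:E) -p0 /p fineK //.
    by apply: fin_num_measure; exact: past_event_measurable.
  - by move=> w /= /not_implyP[].
apply: filterS => w supp.
have [s [Es _]] := past_event_partition n w.
have ps := supp s Es.
rewrite count_runsE; move: Es; rewrite /past_event /= size_tuple => ->.
congr (_%:R); exact: (block_count_full dvdn_card p_rcons _ (size_tuple s) ps).
Qed.

Lemma program_indicE i x (w : Omega X) :
  (program X i w == x)%:R = \1_(runs i x) w :> R.
Proof.
rewrite indicE; case: eqP => h; first by rewrite mem_set.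
by rewrite memNset.
Qed.

Lemma measurable_program_indic i x :
  measurable_fun setT (fun w => (program X i w == x)%:R : R).
Proof.
under eq_fun do rewrite program_indicE.
by apply: measurable_indic; exact: program_measurable.
Qed.

(** The sum is the expected number of runs of [x], and that number is almost surely [b]; no marginal
    probability is computed. *)
Lemma sum_program_prob x : \sum_(i < n) fine (P (runs i x)) = b%:R :> R.
Proof.
transitivity (\int[P]_w count_runs X n x w).
  rewrite /count_runs Rintegral_sum //; last first.
    move=> i; apply: (@integrable_ae_bounded _ _ _ _ _ _ 1) => //.
      exact: measurable_program_indic.
    by apply: aeW => w; case: eqP; rewrite ?normr1 ?normr0.
  apply: eq_bigr => i _; under eq_Rintegral do rewrite program_indicE.
  by rewrite /Rintegral integral_indic ?setIT //; exact: program_measurable.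
transitivity (\int[P]_w (b%:R : R)); last first.
  by rewrite Rintegral_cst // [X in fine X](probability_setT P) /= mulr1.
congr fine; apply: ae_eq_integral => //.
- apply/measurable_EFinP; apply: measurable_sum => i.
  exact: measurable_program_indic.
- by apply: filterS (count_runs_ae x) => w e0 _ /=; rewrite e0.
Qed.

Let total x (w : Omega X) : R :=
  \sum_(i < n) (program X i w == x)%:R * time_at X i w.

Lemma indic_timeE i x :
  (fun w => (program X i w == x)%:R * time_at X i w) = time_at X i \_ (runs i x).
Proof.
apply/funext => w; rewrite patchE program_indicE indicE.
by case: (_ \in _); rewrite ?mul1r ?mul0r.
Qed.

Lemma integrable_time (i : nat) D : (i < n)%N -> measurable D ->
  P.-integrable D (EFin \o time_at X i).
Proof.
move=> i_n mD; apply: integrable_ae_bounded (Xbounded i_n) => //.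
Qed.

Lemma integrable_indic_time i x : (i < n)%N ->
  P.-integrable setT (EFin \o (fun w => (program X i w == x)%:R * time_at X i w)).
Proof.
move=> i_n; rewrite indic_timeE -restrict_EFin.
have mx := program_measurable X i x.
by apply/(integrable_mkcond _ mx); exact: integrable_time.
Qed.

Lemma integrable_total x : P.-integrable setT (EFin \o total x).
Proof.
rewrite (_ : EFin \o total x = fun w => \sum_(i < n)
    ((program X i w == x)%:R * time_at X i w)%:E)%E.
  by apply: integrable_sum => // i _; exact: integrable_indic_time.
by apply/funext => w; rewrite /total /= sumEFin.
Qed.

Lemma Rintegral_time i x : (i < n)%N ->
  \int[P]_(w in runs i x) time_at X i w =
  fine (P (runs i x)) * \int[true_time_law e c x]_t t +
  \int[P]_(w in runs i x) noise_at X i w.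
Proof.
move=> i_n; have mx := program_measurable X i x.
have iT := true_time_integrable additive bounded true_time_gt0 x.
rewrite -(Rintegral_true_time Xadditive i_n iT).
have bnd := noise_ae_bounded Xadditive i_n Xbounded true_time_gt0.
have iN : P.-integrable (runs i x) (EFin \o noise_at X i).
  exact: integrable_ae_bounded bnd.
apply/eqP; rewrite -subr_eq; apply/eqP.
rewrite -RintegralB //; last exact: integrable_time.
by apply: eq_Rintegral => w _; rewrite (Xadditive i_n).1 addrK.
Qed.

Lemma Rintegral_total x : \int[P]_w total x w =
  b%:R * \int[true_time_law e c x]_t t +
  \sum_(i < n) \int[P]_(w in runs i x) noise_at X i w.
Proof.
rewrite /total Rintegral_sum //; last first.
  by move=> i; exact: integrable_indic_time.
rewrite -(sum_program_prob x) mulr_suml -big_split /=.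
apply: eq_bigr => i _; rewrite -Rintegral_time //.
by rewrite indic_timeE -Rintegral_mkcond.
Qed.

Lemma measurable_loss_est x : measurable_fun setT (loss_est X n x).
Proof.
have count_ge0 w : 0 <= count_runs X n x w by exact: sumr_ge0.
(* Inversion is rewritten as a real power, a measurable function. The two agree on nonnegative
   counts, including 0, where both are 0. *)
have -> : loss_est X n x = (fun w => count_runs X n x w `^ (-1)) \* total x.
  by apply/funext => w; rewrite /loss_est /= powR_inv1.
apply: measurable_funM.
  apply: (measurableT_comp (measurable_powR _)); apply: measurable_sum => i.
  exact: measurable_program_indic.
apply: measurable_sum => i; apply: measurable_funM; last exact: measurable_funP.
exact: measurable_program_indic.
Qed.

Lemma expectation_delta_error f g :
  'E_P[delta_error m c f g n X]%E = (b%:R^-1 * \sum_(i < n)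
    (\int[P]_(w in runs i f) noise_at X i w -
     \int[P]_(w in runs i g) noise_at X i w))%:E.
Proof.
(* Replacing the random counts by [b] changes the error only on a null set and makes it linear in
   the times. The true-time means then produce exactly the true delta. *)
pose err w := b%:R^-1 * (total f w - total g w) - true_delta m c f g.
have mtotal x : measurable_fun setT (total x).
  by apply/measurable_EFinP; exact: measurable_int (integrable_total x).
have itotal : P.-integrable setT (EFin \o (fun w => total f w - total g w)).
  exact: (integrableB measurableT (integrable_total f) (integrable_total g)).
have iZ : P.-integrable setT
    (EFin \o (fun w => b%:R^-1 * (total f w - total g w))).
  exact: (integrableZl measurableT _ itotal).
have iD : P.-integrable setT (EFin \o (fun=> true_delta m c f g)).
  exact: finite_measure_integrable_cst.
have ierr : P.-integrable setT (EFin \o err).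
  exact: (integrableB measurableT iZ iD).
have -> : 'E_P[delta_error m c f g n X]%E = (\int[P]_w (err w)%:E)%E.
  rewrite unlock; apply: ae_eq_integral => //.
  - apply/measurable_EFinP; apply: measurable_funB => //.
    by apply: measurable_funB; exact: measurable_loss_est.
  - exact: measurable_int ierr.
  - near=> w => _; congr EFin; rewrite /delta_error /delta_est /loss_est.
    have -> : count_runs X n f w = b%:R by near: w; exact: count_runs_ae.
    have -> : count_runs X n g w = b%:R by near: w; exact: count_runs_ae.
    by rewrite -mulrBr.
rewrite -[LHS]fineK; last exact: (integrable_fin_num measurableT ierr).
congr EFin; rewrite -/(Rintegral _ _ _) RintegralB // RintegralZl //.
rewrite RintegralB //; try exact: integrable_total.
rewrite !Rintegral_total Rintegral_cst // [X in fine X](probability_setT P) /=.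
rewrite (true_deltaE additive bounded true_time_gt0) sumrB mulr1.
by field; exact: block_size_neq0.
Unshelve. all: by end_near. Qed.

Lemma abs_expectation_delta_error_le f g : f != g ->
  (`| 'E_P[delta_error m c f g n X] | <=
   (2 * #|prog|%:R * `| `|M| + A | / Num.sqrt n%:R)%:E)%E.
Proof.
move=> fg; rewrite expectation_delta_error abse_EFin lee_fin normrM.
have cardR_gt0 : 0 < #|prog|%:R :> R by rewrite ltr0n.
have sqrt_gt0 : 0 < Num.sqrt n%:R :> R by rewrite sqrtr_gt0 ltr0n.
(* Since 1 / b = F / n, writing n as the square of sqrt n lets one factor cancel the sqrt n of the
   summed bounds. *)
have bV : `|b%:R^-1| = #|prog|%:R / Num.sqrt n%:R ^+ 2 :> R.
  rewrite sqr_sqrtr // -{2}(divnK dvdn_card) natrM ger0_norm ?invr_ge0 //.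
  by field; rewrite block_size_neq0 gt_eqF.
have sum_le : `|\sum_(i < n) (\int[P]_(w in runs i f) noise_at X i w -
     \int[P]_(w in runs i g) noise_at X i w)| <=
     `| `|M| + A | * (2 * Num.sqrt n%:R).
  apply: le_trans (ler_norm_sum _ _ _) _.
  apply: (le_trans _ (ler_wpM2l (normr_ge0 _) (sum_inv_sqrt_le R n))).
  by rewrite mulr_sumr; apply: ler_sum => i _; exact: block_noise_diff_le.
apply: le_trans (ler_wpM2l (normr_ge0 _) sum_le) _.
by rewrite bV le_eqVlt; apply/orP; left; apply/eqP; field; rewrite gt_eqF.
Qed.

End SingleBlock.

Theorem theorem24 (R : realType) (prog : finType) (config : Type)
    (d : measure_display) (state : measurableType d)
    (m : model R prog config state) (e : effects R prog config state)
    (M : R) (c : config) (f g : prog) (X : nat -> experiment R prog state) :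
  (2 <= #|prog|)%N -> f != g ->
  reference_additive m e c -> reference_bounded m M c ->
  (forall n, (0 < n)%N -> (#|prog| %| n)%N ->
    delta_design m e M c (single_block n) n (X n)) ->
  exists K : R, \forall n \near \oo, (#|prog| %| n)%N ->
    (`| 'E_(Pr (X n))[delta_error m c f g n (X n)] |
       <= (K * n%:R `^ (- 2^-1))%:E)%E.
Proof.
move=> _ fg additive bounded Xdelta.
have [k true_time_gt0] := exists_norm_le_gt0_fin (true_time_law e c).
(* The radius [k] depends only on the true-time laws, so the constant is the same for all [n] and
   all experiments. The bound holds at every positive multiple of F, whence the threshold 1. *)
exists (2 * #|prog|%:R * `| `|M| + k%:R |).
exists 1%N => // n /= n_gt0 dvdn_card; rewrite powRN powR12_sqrt //.
exact: abs_expectation_delta_error_le additive bounded true_time_gt0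
  (Xdelta n n_gt0 dvdn_card) _ _ fg.
Qed.
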